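(* Let $S_1,S_2$ be linear control subsystems $\dot x^i=A^ix^i+B^iu^i$, $i\in\{1,2\}$, with LQR weights $Q^i$ (positive semidefinite) and $R^i$ (positive definite), let $K$ be a composition matrix, and let $P^1,P^2,\mathcal{P}$ be the positive semidefinite Riccati solutions of the subsystem LQR problems and of the composite LQR problem, respectively. Put $\bar P=\operatorname{diag}(P^1,P^2)$ (block diagonal). Then the matrix $K\mathcal{P}$ (from the LQR design for the composite system) and the matrix $\bar P K$ (from the composition of the LQR designs for the subsystems) are both solutions $X\in\mathbb{R}^{(n_1+n_2)\times(n_1+n_2-k)}$ of the General Algebraic Riccati equation $$\mathbf{0}=-X^\top\bar A K-K^\top\bar A^\top X-\mathcal{Q}+X^\top\bar B\bar R^{-1}\bar B^\top X.$$
   Context: Subsystems: $A^i\in\mathbb{R}^{n_i\times n_i}$, $B^i\in\mathbb{R}^{n_i\times m_i}$, $Q^i\in\mathbb{R}^{n_i\times n_i}$ symmetric positive semidefinite, $R^i\in\mathbb{R}^{m_i\times m_i}$ symmetric positive definite, $i\in\{1,2\}$. Composition matrix: the two systems with state vectors $x^1\in\mathbb{R}^{n_1}$ and $x^2\in\mathbb{R}^{n_2}$ share $k\le\min\{n_1,n_2\}$ states, i.e. $k$ distinct coordinates of $x^1$ are identified one-to-one with $k$ distinct coordinates of $x^2$. The composite state $\bar x\in\mathbb{R}^{n_1+n_2-k}$ has one coordinate for each shared state and one for each non-shared state. With $\delta_i$ the $i$-th standard basis (column) vector of $\mathbb{R}^{n_1+n_2-k}$, the matrix $K\in\mathbb{R}^{(n_1+n_2)\times(n_1+n_2-k)}$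 has rows: $K_{j,:}=\delta_i^\top$ if $\bar x_i$ is non-shared and $\bar x_i=x^1_j$; $K_{l+n_1,:}=\delta_i^\top$ if $\bar x_i$ is non-shared and $\bar x_i=x^2_l$; and $K_{j,:}=K_{l+n_1,:}=\delta_i^\top$ if $\bar x_i$ is shared with $\bar x_i=x^1_j=x^2_l$. Block-diagonal matrices: $\bar A=\operatorname{diag}(A^1,A^2)$, $\bar B=\operatorname{diag}(B^1,B^2)$, $\bar R=\operatorname{diag}(R^1,R^2)$. Composite matrices: $\mathcal{A}=K^\top\bar A K$, $\mathcal{B}=K^\top\bar B$, $\mathcal{Q}=K^\top\operatorname{diag}(Q^1,Q^2)K$. Subsystem LQR (cost $\int_0^\infty (x^i)^\top Q^ix^i+(u^i)^\top R^iu^i\,d\tau$): $P^i$ is the symmetric positive semidefinite solution (defining the optimal control $u^i=-(R^i)^{-1}(B^i)^\top P^ix^i$) of $\mathbf{0}=-P^iA^i-(A^i)^\top P^i-Q^i+P^iB^i(R^i)^{-1}(B^i)^\top P^i$. Composite LQR (system $\dot{\bar x}=\mathcal{A}\bar x+\mathcal{B}\bar u$, cost $\int_0^\infty\bar x^\top\mathcal{Q}\bar x+\bar u^\top\bar R\bar u\,d\tau$): $\mathcal{P}$ is the symmetric positive semidefinite solution (defining the optimal control $\bar u=-\bar R^{-1}\mathcal{B}^\top\mathcal{P}\bar x$) of $\mathbf{0}=-\mathcal{P}\mathcal{A}-\mathcal{A}^\top\mathcal{P}-\mathcal{Q}+\mathcal{P}\mathcal{B}\bar R^{-1}\mathcal{B}^\top\mathcal{P}$.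 *)

(* Defs.v *)
From mathcomp Require Import all_boot all_order all_algebra.
From mathcomp Require Import reals.

Set Implicit Arguments.
Unset Strict Implicit.
Unset Printing Implicit Defensive.

Import Order.TTheory GRing.Theory Num.Theory.

Local Open Scope ring_scope.

Definition psdmx (R : realType) (n : nat) (M : 'M[R]_n) : Prop :=
  M \is symmetricmx /\ forall x : 'cV[R]_n, 0 <= (x^T *m M *m x) 0 0.

Definition pdmx (R : realType) (n : nat) (M : 'M[R]_n) : Prop :=
  M \is symmetricmx /\
  forall x : 'cV[R]_n, x != 0 -> 0 < (x^T *m M *m x) 0 0.

Definition bdiag (R : realType) (a b c d : nat)
    (M : 'M[R]_(a, b)) (N : 'M[R]_(c, d)) : 'M[R]_(a + c, b + d) :=
  block_mx M 0 0 N.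

(* The t-th shared state is coordinate [shared1 t] of x^1 and coordinate
   [shared2 t] of x^2.  Coordinate j of x^1 (resp. l of x^2) is coordinate
   [pos1 j] (resp. [pos2 l]) of the composite state, whose coordinates may be
   ordered arbitrarily.  The truncated subtraction is harmless: injectivity of
   [shared1] and [shared2] forces k <= minn n1 n2. *)
Record composition (n1 n2 k : nat) := Composition {
  shared1 : 'I_k -> 'I_n1;
  shared2 : 'I_k -> 'I_n2;
  pos1 : 'I_n1 -> 'I_(n1 + n2 - k);
  pos2 : 'I_n2 -> 'I_(n1 + n2 - k);
  shared1_inj : injective shared1;
  shared2_inj : injective shared2;
  pos1_inj : injective pos1;
  pos2_inj : injective pos2;
  pos_shared : forall j l,
    pos1 j = pos2 l <-> exists t, shared1 t = j /\ shared2 t = l;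
  pos_cover : forall i, (exists j, pos1 j = i) \/ (exists l, pos2 l = i)
}.

(* [delta_mx 0 i : 'rV_n] is the transpose of the i-th standard basis vector;
   a shared coordinate i gives this row in both blocks, a non-shared one in
   exactly one of them. *)
Definition composition_mx (R : realType) (n1 n2 k : nat)
    (C : composition n1 n2 k) : 'M[R]_(n1 + n2, n1 + n2 - k) :=
  col_mx (\matrix_(j < n1) (delta_mx 0 (pos1 C j) : 'rV_(n1 + n2 - k)))
         (\matrix_(l < n2) (delta_mx 0 (pos2 C l) : 'rV_(n1 + n2 - k))).

(* A positive semidefinite solution of the Riccati equation of the LQR problem
   with dynamics (A, B) and weights (Q, W). *)
Definition lqr_riccati_sol (R : realType) (n m : nat)
    (A : 'M[R]_n) (B : 'M[R]_(n, m)) (Q : 'M[R]_n) (W : 'M[R]_m)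
    (P : 'M[R]_n) : Prop :=
  psdmx P /\
  0 = - (P *m A) - A^T *m P - Q + P *m B *m invmx W *m B^T *m P.

Definition gare_sol (R : realType) (n m r : nat)
    (K : 'M[R]_(n, r)) (A : 'M[R]_n) (B : 'M[R]_(n, m)) (Q : 'M[R]_r)
    (W : 'M[R]_m) (X : 'M[R]_(n, r)) : Prop :=
  0 = - (X^T *m A *m K) - K^T *m A^T *m X - Q
      + X^T *m B *m invmx W *m B^T *m X.

(* Main.v *)
(* Since P and Pbar are symmetric, substituting X = K P turns the general
   equation into the composite Riccati equation itself, while X = Pbar K turns
   it into K^T E K = 0, where E = 0 is the Riccati equation of the uncoupled
   block-diagonal system.  The shape of K plays no role. *)
Require Import Defs.
From mathcomp Require Import all_boot all_order all_algebra.
From mathcomp Require Import reals.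

Set Implicit Arguments.
Unset Strict Implicit.
Unset Printing Implicit Defensive.

Import Order.TTheory GRing.Theory Num.Theory.

Local Open Scope ring_scope.

Lemma psdmx_tr (R : realType) (n : nat) (M : 'M[R]_n) : psdmx M -> M^T = M.
Proof.
(* [symmetricmx] is the hermitian predicate with sign [(-1) ^+ false] and the identity as
   conjugation; both factors are removed here. *)
by case=> /is_hermitianmxP M_sym _; rewrite [RHS]M_sym expr0 scale1r map_mx_id.
Qed.

(** A row [v] in the left kernel satisfies [v *m M *m v^T = 0], so positivity at the column [v^T]
    forces [v = 0]. *)
Lemma pdmx_unit (R : realType) (n : nat) (M : 'M[R]_n) :
  pdmx M -> M \in unitmx.
Proof.
case=> _ M_pos; rewrite -row_free_unit -kermx_eq0; apply/rowV0P => v.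
move=> /sub_kermxP vM0; apply/eqP; apply: contraT => v_neq0.
have := M_pos v^T; rewrite trmx_eq0 trmxK vM0 mul0mx mxE ltxx.
by move=> /(_ v_neq0).
Qed.

(** Every operation acts blockwise. For the inverse this rests on both weights being units: [invmx]
    returns a singular matrix unchanged, so one singular block would leave the other uninverted. *)
Lemma bdiag_riccati (R : realType) (n1 n2 m1 m2 : nat)
    (A1 : 'M[R]_n1) (B1 : 'M[R]_(n1, m1)) (Q1 : 'M[R]_n1) (W1 : 'M[R]_m1)
    (A2 : 'M[R]_n2) (B2 : 'M[R]_(n2, m2)) (Q2 : 'M[R]_n2) (W2 : 'M[R]_m2)
    (P1 : 'M[R]_n1) (P2 : 'M[R]_n2) :
  W1 \in unitmx -> W2 \in unitmx ->
  let A := bdiag A1 A2 in let B := bdiag B1 B2 in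
  let P := bdiag P1 P2 in
  0 = - (P1 *m A1) - A1^T *m P1 - Q1 + P1 *m B1 *m invmx W1 *m B1^T *m P1 ->
  0 = - (P2 *m A2) - A2^T *m P2 - Q2 + P2 *m B2 *m invmx W2 *m B2^T *m P2 ->
  0 = - (P *m A) - A^T *m P - bdiag Q1 Q2
      + P *m B *m invmx (bdiag W1 W2) *m B^T *m P.
Proof.
move=> W1_unit W2_unit /= eq1 eq2; rewrite /bdiag invmx_block_diag; last first.
  by rewrite block_diag_mx_unit W1_unit.
rewrite !tr_block_mx !trmx0 !mulmx_block.
rewrite !(mulmx0, mul0mx, addr0, add0r) !opp_block_mx !add_block_mx.
by rewrite -eq1 -eq2 !(oppr0, addr0) block_mx_const.
Qed.

Theorem theorem4 (R : realType) (n1 n2 m1 m2 k : nat)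
    (k_le : (k <= minn n1 n2)%N)
    (A1 : 'M[R]_n1) (B1 : 'M[R]_(n1, m1)) (Q1 : 'M[R]_n1) (R1 : 'M[R]_m1)
    (A2 : 'M[R]_n2) (B2 : 'M[R]_(n2, m2)) (Q2 : 'M[R]_n2) (R2 : 'M[R]_m2)
    (Q1_psd : psdmx Q1) (Q2_psd : psdmx Q2)
    (R1_pd : pdmx R1) (R2_pd : pdmx R2)
    (C : composition n1 n2 k)
    (P1 : 'M[R]_n1) (P2 : 'M[R]_n2) (P : 'M[R]_(n1 + n2 - k)) :
  let K : 'M[R]_(n1 + n2, n1 + n2 - k) := composition_mx R C in
  let Abar : 'M[R]_(n1 + n2) := bdiag A1 A2 in
  let Bbar : 'M[R]_(n1 + n2, m1 + m2) := bdiag B1 B2 in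
  let Rbar : 'M[R]_(m1 + m2) := bdiag R1 R2 in
  let Pbar : 'M[R]_(n1 + n2) := bdiag P1 P2 in
  let Acomp : 'M[R]_(n1 + n2 - k) := K^T *m Abar *m K in
  let Bcomp : 'M[R]_(n1 + n2 - k, m1 + m2) := K^T *m Bbar in
  let Qcomp : 'M[R]_(n1 + n2 - k) := K^T *m bdiag Q1 Q2 *m K in
  lqr_riccati_sol A1 B1 Q1 R1 P1 ->
  lqr_riccati_sol A2 B2 Q2 R2 P2 ->
  lqr_riccati_sol Acomp Bcomp Qcomp Rbar P ->
  gare_sol K Abar Bbar Qcomp Rbar (K *m P) /\
  gare_sol K Abar Bbar Qcomp Rbar (Pbar *m K).
Proof.
move=> K Abar Bbar Rbar Pbar Acomp Bcomp Qcomp.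
move=> [P1_psd eq1] [P2_psd eq2] [P_psd eq]; split; rewrite /gare_sol trmx_mul.
  (* Here [X^T] is [P *m K^T], and the transposes of [Acomp] and [Bcomp] expand so that both
     equations agree up to associativity. *)
  move: eq; rewrite (psdmx_tr P_psd) /Acomp /Bcomp !trmx_mul trmxK.
  by rewrite !mulmxA.
have -> : Pbar^T = Pbar.
  by rewrite tr_block_mx !trmx0 (psdmx_tr P1_psd) (psdmx_tr P2_psd).
have := bdiag_riccati (pdmx_unit R1_pd) (pdmx_unit R2_pd) eq1 eq2.
(* Congruence by [K] turns [bdiag Q1 Q2] into [Qcomp]; the outer factors [K^T *m Pbar] and
   [Pbar *m K] are [X^T] and [X]. *)
move=> /(congr1 (fun E => K^T *m E *m K)).
rewrite mulmx0 mul0mx !(mulmxDr, mulmxDl, mulmxN, mulNmx).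
by rewrite !mulmxA.
Qed.
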